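(* For integers $n\ge 0$ and $0\le k\le \lfloor n/2\rfloor$, the number $c_{n,k}$ of tilings of the honeycomb strip $H_n$ using exactly $k$ dimers and $n-2k$ monomers equals $$c_{n,k}=\sum_{m=0}^{k}\binom{n-k-m}{m}\binom{n-k-m}{n-2k}.$$
   Context: The honeycomb strip $H_n$ consists of $n$ regular hexagons arranged in two rows, numbered $1,\dots,n$ from the bottom left so that odd-numbered hexagons form the bottom row and even-numbered ones the top row; hexagon $i$ shares an edge with hexagons $i\pm1$ and $i\pm2$ (when they exist), and with no others. A monomer is a single hexagon; a dimer is a pair of edge-adjacent hexagons, i.e. either $\{i,i+1\}$ (slanted) or $\{i,i+2\}$ (horizontal). A tiling of $H_n$ is a partition of its $n$ hexagons into monomers and dimers. Binomial coefficients $\binom{a}{b}$ with $b>a\ge0$ or $b<0$ are $0$. *)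

(* Defs.v *)
From mathcomp Require Import all_boot.
Set Implicit Arguments.
Unset Strict Implicit.
Unset Printing Implicit Defensive.

(* The honeycomb strip H_n is the graph on its hexagons; the index i : 'I_n
   stands for hexagon number i + 1, so even indices form the bottom row. *)
Definition hex_adj (n : nat) : rel 'I_n :=
  fun i j => [|| j == i + 1 :> nat, i == j + 1 :> nat,
                 j == i + 2 :> nat | i == j + 2 :> nat].

Definition monomer (n : nat) (B : {set 'I_n}) : bool :=
  [exists i : 'I_n, B == [set i]].

Definition dimer (n : nat) (B : {set 'I_n}) : bool :=
  [exists i : 'I_n, exists j : 'I_n, hex_adj i j && (B == [set i; j])].

Definition tiling (n : nat) (P : {set {set 'I_n}}) : bool :=
  partition P [set: 'I_n] && [forall B in P, monomer B || dimer B].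

(* c_{n,k} *)
Definition num_tilings (n k : nat) : nat :=
  #|[set P : {set {set 'I_n}} |
      [&& tiling P,
          #|[set B in P | dimer B]| == k &
          #|[set B in P | monomer B]| == n - 2 * k]]|.

(* Main.v *)
Require Import Defs.
From mathcomp Require Import all_boot.
From mathcomp Require Import zify.

(** The first hexagon of a strip is a monomer, or is paired with the second
hexagon, or is paired with the third one; in the last case the second hexagon
is a monomer or is paired with the fourth one.  Hence the number of tilings
with [l] monomers and [k] dimers obeys
[c(l,k) = c(l-1,k) + c(l,k-1) + c(l-1,k-1) + c(l,k-2)], and Pascal's rule
applied to both binomial coefficients shows that the sum obeys it as well. *)

(** * Blocks: monomers, dimers and their partners *)

Lemma card_set_in_U1 {T : finType} (p : pred T) (A : {set T}) (x : T) :
  x \notin A -> #|[set y in x |: A | p y]| = p x + #|[set y in A | p y]|.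
Proof.
move=> xA; case px: (p x); last first.
  apply: eq_card => y; rewrite !inE; case: eqP => [->|] //=.
  by rewrite px andbF.
have -> : [set y in x |: A | p y] = x |: [set y in A | p y].
  by apply/setP => y; rewrite !inE; case: eqP => [->|].
by rewrite cardsU1 !inE (negbTE xA).
Qed.

(** The degenerate pair [[set x; x]] is included, so the block of [x] determines the partner of [x]
    even for a monomer. *)
Lemma set2_inj {T : finType} (x : T) : injective (fun y => [set x; y]).
Proof.
move=> y z /setP E.
have := E y; have := E z; rewrite !inE !eqxx !orbT.
by do 2![case: eqP => [->|] //=]; rewrite eq_sym => ? /eqP.
Qed.

Lemma hex_adj_irr (n : nat) : irreflexive (@hex_adj n).
Proof. by move=> i; rewrite /hex_adj; lia. Qed.

Lemma monomer_card {n : nat} (B : {set 'I_n}) : monomer B = (#|B| == 1).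
Proof.
apply/existsP/cards1P => [[i /eqP ->]|[i ->]]; first by exists i.
by exists i.
Qed.

Lemma dimer_card {n : nat} {B : {set 'I_n}} : dimer B -> #|B| = 2.
Proof.
case/existsP=> i /existsP[j /andP[ij /eqP->]]; rewrite cards2.
by case: eqP ij => // ->; rewrite hex_adj_irr.
Qed.

Lemma dimer_set2 {n : nat} (i j : 'I_n) : hex_adj i j -> dimer [set i; j].
Proof.
by move=> ij; apply/existsP; exists i; apply/existsP; exists j; rewrite ij eqxx.
Qed.

Lemma hex_adj_sym (n : nat) : symmetric (@hex_adj n).
Proof. by move=> i j; rewrite /hex_adj; lia. Qed.

Lemma dimer_partner {n : nat} {B : {set 'I_n}} {x : 'I_n} :
  dimer B -> x \in B -> exists2 y, hex_adj x y & B = [set x; y].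
Proof.
case/existsP=> i /existsP[j /andP[ij /eqP->]] /set2P[] ->; first by exists j.
by exists i; [rewrite hex_adj_sym | rewrite setUC].
Qed.

(** * Tilings of an arbitrary set of hexagons *)

(** Removing a block from a strip need not leave a strip, so the recursion runs over subsets [D] of
    a fixed ['I_n]. *)
Definition region_tilings {n : nat} (D : {set 'I_n}) (l k : nat) : {set {set {set 'I_n}}} :=
  [set P | [&& partition P D, [forall B in P, monomer B || dimer B],
               #|[set B in P | dimer B]| == k &
               #|[set B in P | monomer B]| == l]].

(** Inserting [B] is a bijection from the tilings of [D :\: B]: a nonempty [B] is never a block of
    these, so it can be removed again. The coercion of [monomer B] and [dimer B] to 0 or 1 treats
    both kinds of block at once. *)
Lemma card_tilings_block {n : nat} (D B : {set 'I_n}) (l k : nat) :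
    B \subset D -> monomer B || dimer B ->
  #|[set P in region_tilings D (monomer B + l) (dimer B + k) | B \in P]| =
  #|region_tilings (D :\: B) l k|.
Proof.
move=> sBD tB.
have nzB : B != set0.
  rewrite -card_gt0; case/orP: tB => [|/dimer_card->] //.
  by rewrite monomer_card => /eqP->.
have notin P : P \in region_tilings (D :\: B) l k -> B \notin P.
  rewrite inE => /and4P[pP _ _ _]; apply/negP => BP.
  have := subsetP (partitionS pP BP); case/set0Pn: nzB => x xB.
  by move=> /(_ x xB); rewrite inE xB.
rewrite -[RHS](card_in_imset (f := fun P => B |: P)); last first.
  by move=> P Q /notin PB /notin QB E; rewrite -(setU1K PB) E setU1K.
apply: eq_card => P; apply/idP/imsetP => [|[Q QT ->]].
  rewrite !inE => /andP[/and4P[pP aP kP lP] BP]; exists (P :\ B); last by rewrite setD1K.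
  have BN : B \notin P :\ B by rewrite !inE eqxx.
  rewrite !inE partitionD1 //=; apply/and3P; split.
  - by apply/forall_inP=> C /setD1P[_ CP]; apply: (forall_inP aP).
  - by move: kP; rewrite -[in X in X -> _](setD1K BP) card_set_in_U1 // eqn_add2l.
  - by move: lP; rewrite -[in X in X -> _](setD1K BP) card_set_in_U1 // eqn_add2l.
have BQ := notin _ QT; move: QT; rewrite !inE => /and4P[pQ aQ kQ lQ].
rewrite eqxx !card_set_in_U1 // !eqn_add2l kQ lQ !andbT; apply/andP; split.
  have := partitionU1 pQ nzB.
  have -> : B :|: D :\: B = D by rewrite -{1}(setIidPr sBD) setID.
  by apply; rewrite disjoint_sym disjoints_subset subDset setUCr subsetT.
apply/forall_inP=> C /setU1P[->//|CQ]; exact: (forall_inP aQ).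
Qed.

(** Tilings are sorted by the block that covers [x]; a class is empty when no block of its kind is
    left to use. *)
Lemma card_tilings_rec {n : nat} (D : {set 'I_n}) (x : 'I_n) (l k : nat) : x \in D ->
  #|region_tilings D l k| =
    (if l is l'.+1 then #|region_tilings (D :\ x) l' k| else 0) +
    (if k is k'.+1 then
       \sum_(y in D | hex_adj x y) #|region_tilings (D :\: [set x; y]) l k'|
     else 0).
Proof.
move=> xD; set T := region_tilings D l k.
have part y : #|[set P in T | [set x; y] \in P]| = \sum_(P in T) ([set x; y] \in P : nat).
  rewrite -sum1_card [RHS]big_mkcond [LHS]big_mkcond /=.
  by apply: eq_bigr => P _; rewrite inE; case: (_ \in T); case: (_ \in P).
(* [y = x] encodes that [x] is a monomer, since [set x; x] = [set x]. *)
have -> : #|T| = \sum_(y in D | (y == x) || hex_adj x y) #|[set P in T | [set x; y] \in P]|.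
  under eq_bigr => y _ do rewrite part.
  rewrite exchange_big -sum1_card /=; apply: eq_bigr => P.
  rewrite inE => /and4P[pP aP _ _].
  have xcov : x \in cover P by rewrite (cover_partition pP).
  have BP := pblock_mem xcov.
  have xB : x \in pblock P x by rewrite mem_pblock.
  have [y xy Bxy] : exists2 y, (y == x) || hex_adj x y & pblock P x = [set x; y].
    case/orP: (forall_inP aP _ BP) => [/existsP[i /eqP Bi]|dB].
      by exists x; rewrite ?eqxx // setUid; move: xB; rewrite Bi => /set1P->.
    by have [y xy ->] := dimer_partner dB xB; exists y; rewrite ?xy ?orbT.
  have yD : y \in D.
    by apply: (subsetP (partitionS pP BP)); rewrite Bxy !inE eqxx orbT.
  (* Each tiling is counted once: a block [[set x; z]] of [P] contains [x], hence is [pblock P x],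
     which forces [z = y]. *)
  rewrite (bigD1 y) /= ?yD ?xy // -Bxy BP big1 // => z /andP[_ zy].
  apply/eqP; rewrite eqb0; apply: contra zy => zP; apply/eqP/(@set2_inj _ x).
  by rewrite -Bxy (def_pblock (partition_trivIset pP) zP) // !inE eqxx.
rewrite (bigD1 x) /= ?xD ?eqxx //; congr (_ + _).
  rewrite setUid.
  have mx : monomer [set x] by rewrite monomer_card cards1.
  have dx : dimer [set x] = false.
    by apply/negbTE/negP => /dimer_card; rewrite cards1.
  rewrite /T; case: l {T part} => [|l].
    apply: eq_card0 => P; rewrite !inE; apply/negP => /andP[/and4P[_ _ _]].
    by rewrite cards_eq0 => /eqP/setP/(_ [set x]); rewrite !inE mx andbT => ->.
  have := @card_tilings_block n D [set x] l k; rewrite mx dx; apply => //.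
  by rewrite sub1set.
have dxy y : hex_adj x y -> dimer [set x; y] by exact: dimer_set2.
rewrite (eq_bigl (fun y => (y \in D) && hex_adj x y)); last first.
  move=> y; rewrite -andbA; congr (_ && _).
  by case: eqP => [->|_]; rewrite ?hex_adj_irr //= andbT.
rewrite /T; case: k {T part} => [|k].
  apply: big1 => y /andP[_ xy]; apply: eq_card0 => P.
  rewrite !inE; apply/negP => /andP[/and4P[_ _ + _]].
  by rewrite cards_eq0 => /eqP/setP/(_ [set x; y]); rewrite !inE dxy // andbT => ->.
apply: eq_bigr => y /andP[yD xy].
have := @card_tilings_block n D [set x; y] l k.
rewrite dxy // monomer_card (dimer_card (dxy _ xy)); apply; last by rewrite orbT.
by apply/subsetP => z /set2P[] ->.
Qed.

Lemma region_tilings0 (n : nat) : #|region_tilings (@set0 'I_n) 0 0| = 1.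
Proof.
apply/eqP/cards1P; exists set0; apply/setP => P; rewrite !inE partition_set0.
case: eqP => //= ->; apply/and3P; split; last 2 first.
- by rewrite cards_eq0; apply/eqP/setP => B; rewrite !inE.
- by rewrite cards_eq0; apply/eqP/setP => B; rewrite !inE.
by apply/forall_inP => B; rewrite inE.
Qed.

Definition suffix_region (n a : nat) : {set 'I_n} := [set i : 'I_n | a <= i].

(** * The binomial sum and its recurrences *)

(** The sum of the theorem in terms of [l = n - 2k] monomers and [k] dimers, so that
    [n - k = l + k]. *)
Definition binomial_sum (l k : nat) : nat :=
  \sum_(m < k.+1) 'C(l + k - m, m) * 'C(l + k - m, l).

Lemma binomial_sum0 (l : nat) : binomial_sum l 0 = 1.
Proof. by rewrite /binomial_sum big_ord1 subn0 bin0 addn0 binn. Qed.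

Lemma binomial_sum1 (l : nat) : binomial_sum l 1 = l.*2.+1.
Proof.
rewrite /binomial_sum big_ord_recl big_ord1 /= subn0 bin0 /bump /=.
by rewrite addnK bin1 binn addn1 binSn; lia.
Qed.

(** Without monomers the second factor is 1, and the diagonal sums of Pascal's triangle are
    Fibonacci numbers. *)
Lemma binomial_sum0S k :
  binomial_sum 0 k.+2 = binomial_sum 0 k.+1 + binomial_sum 0 k.
Proof.
rewrite /binomial_sum !add0n.
under eq_bigr do rewrite bin0 muln1.
under [in RHS]eq_bigr do rewrite bin0 muln1.
under [X in _ = _ + X]eq_bigr do rewrite bin0 muln1.
(* The terms at [m = 0] cancel, and the last term on the left is ['C(0, k.+2) = 0]. *)
rewrite big_ord_recl [in RHS]big_ord_recl big_ord_recr /= !subn0 !bin0 subnn bin0n addn0.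
rewrite -addnA; congr (_ + _).
rewrite [in RHS]addnC -big_split /=.
apply: eq_bigr => i _; rewrite /bump /= !add1n !subSS.
by rewrite subSn ?binS -1?ltnS // addnC.
Qed.

(** The added term at [m = k.+1] has the factor ['C(l, l.+1) = 0]; range and upper indices now agree
    with those of [binomial_sum l k.+1]. *)
Lemma binomial_sumSl l k :
  binomial_sum l.+1 k =
  \sum_(m < k.+2) 'C(l + k.+1 - m, m) * 'C(l + k.+1 - m, l.+1).
Proof.
rewrite big_ord_recr /= addnK [X in _ * X]bin_small // muln0 addn0.
by rewrite /binomial_sum addSnnS.
Qed.

Lemma binomial_sumSS l k :
  binomial_sum l.+1 k.+2 =
  binomial_sum l k.+2 + binomial_sum l.+1 k.+1 +
  binomial_sum l k.+1 + binomial_sum l.+1 k.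
Proof.
rewrite [binomial_sum l.+1 k.+1]binomial_sumSl [binomial_sum l.+1 k]binomial_sumSl.
rewrite /binomial_sum big_ord_recl [in RHS]big_ord_recl.
rewrite [X in _ = _ + X + _ + _]big_ord_recl /= !subn0 !bin0 !mul1n addSn binS.
(* Pascal's rule splits the term at [m = 0] into [a + b]. Each later term is a product of two
   binomials with upper index [N.+1], where [N = l + k.+1 - i]; its four partial products feed [d],
   [e], [f], [g]. *)
have arith a b c d e f g : c = d + e + f + g -> a + b + c = b + d + (a + e) + f + g by lia.
apply: arith; rewrite -!big_split /=; apply: eq_bigr => i _.
rewrite /bump /= !add1n subSS.
have -> : l + k.+2 - i = (l + k.+1 - i).+1 by have := ltn_ord i; lia.
have -> : l + k.+2 - i.+1 = l + k.+1 - i by lia.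
by rewrite !binS; lia.
Qed.

(** * Counting the tilings of suffixes of the strip *)

Lemma suffix_region_full n : suffix_region n 0 = [set: 'I_n].
Proof. by apply/setP => i; rewrite !inE. Qed.

Lemma suffix_region_empty n : suffix_region n n = set0.
Proof. by apply/setP => i; rewrite !inE leqNgt ltn_ord. Qed.

Lemma sum_ord_val_eq {n : nat} (j : nat) (p : pred 'I_n) (F : 'I_n -> nat) (c : nat) :
    (forall i, p i = (i == j :> nat)) -> (forall i, p i -> F i = c) ->
  \sum_(i | p i) F i = if j < n then c else 0.
Proof.
move=> pj Fc; rewrite (eq_bigr _ Fc); case: ltnP => [jn|nj].
  by rewrite (big_pred1 (Ordinal jn)) // => i; rewrite pj.
by rewrite big_pred0 // => i; rewrite pj; have := ltn_ord i; lia.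
Qed.

(** Of the neighbours of the isolated hexagon [a.+1], only [a.+3] can still lie in the region. *)
Lemma card_tilings_gap {n : nat} (a l k : nat) (x y : 'I_n) :
    x = a :> nat -> y = a.+2 :> nat ->
  #|region_tilings (suffix_region n a :\: [set x; y]) l k| =
    (if l is l'.+1 then #|region_tilings (suffix_region n a.+3) l' k| else 0) +
    (if k is k'.+1 then
       if a.+3 < n then #|region_tilings (suffix_region n a.+4) l k'| else 0
     else 0).
Proof.
move=> xa ya; have zn : a.+1 < n by have := ltn_ord y; lia.
pose z := Ordinal zn.
rewrite (@card_tilings_rec _ _ z); last by rewrite !inE -!val_eqE /=; lia.
congr (_ + _).
  case: l => // l; congr #|region_tilings _ _ _|.
  by apply/setP => i; rewrite !inE -!val_eqE /=; lia.
case: k => // k; apply: sum_ord_val_eq => i.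
  by rewrite !inE /hex_adj -!val_eqE /=; lia.
rewrite !inE /hex_adj -!val_eqE /= => zi; congr #|region_tilings _ _ _|.
by apply/setP => j; rewrite !inE -!val_eqE /=; lia.
Qed.

Lemma card_tilings_suffix_rec {n : nat} (a l k : nat) : a < n ->
  #|region_tilings (suffix_region n a) l k| =
    (if l is l'.+1 then #|region_tilings (suffix_region n a.+1) l' k| else 0) +
    (if k is k'.+1 then
       (if a.+1 < n then #|region_tilings (suffix_region n a.+2) l k'| else 0) +
       (if a.+2 < n then
          (if l is l'.+1 then #|region_tilings (suffix_region n a.+3) l' k'| else 0) +
          (if k' is k''.+1 then
             if a.+3 < n then #|region_tilings (suffix_region n a.+4) l k''| else 0
           else 0)
        else 0)
     else 0).
Proof.
move=> an; rewrite (@card_tilings_rec _ _ (Ordinal an)); last by rewrite inE.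
congr (_ + _).
  case: l => // l; congr #|region_tilings _ _ _|.
  by apply/setP => i; rewrite !inE -!val_eqE /=; lia.
(* The neighbours of [a] in the suffix are [a.+1], which leaves a suffix, and [a.+2], which leaves a
   gap. *)
case: k => // k; rewrite (bigID (fun y : 'I_n => y == a.+1 :> nat)) /=; congr (_ + _).
  apply: sum_ord_val_eq => i; first by rewrite !inE /hex_adj /=; lia.
  rewrite !inE /hex_adj /= => ai; congr #|region_tilings _ _ _|.
  by apply/setP => j; rewrite !inE -!val_eqE /=; lia.
apply: sum_ord_val_eq => i; first by rewrite !inE /hex_adj /=; lia.
by rewrite !inE /hex_adj /= => ai; apply: card_tilings_gap => //=; lia.
Qed.

(** Strong induction on the number [l + k] of blocks, since filling a gap uses up two blocks at
    once. *)
Lemma card_tilings_suffix {n : nat} (a l k : nat) : a + l + 2 * k = n ->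
  #|region_tilings (suffix_region n a) l k| = binomial_sum l k.
Proof.
have [s] := ubnP (l + k); elim: s a l k => // s IH a l k ls aln.
case: (posnP (l + k)) => [/eqP|lk].
  rewrite addn_eq0 => /andP[/eqP l0 /eqP k0]; rewrite l0 k0 binomial_sum0 in aln *.
  by rewrite (_ : a = n) ?suffix_region_empty ?region_tilings0; lia.
rewrite card_tilings_suffix_rec; last by lia.
(* The equation [aln] decides the bounds against [n]; each case is then a base value or a recurrence
   of [binomial_sum]. *)
case: k => [|[|k]] in ls aln lk *; case: l => [|l] in ls aln lk *;
  rewrite ?addn0 ?if_same ?ifT ?IH ?binomial_sum0 ?binomial_sum1 ?binomial_sum0S
          ?binomial_sumSS; lia.
Qed.

Theorem theorem2 (n k : nat) (hk : k <= n %/ 2) :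
  num_tilings n k =
  \sum_(0 <= m < k.+1) 'C(n - k - m, m) * 'C(n - k - m, n - 2 * k).
Proof.
(* By [hk] the subtraction is not truncated, so the whole strip is the suffix at [a = 0]. *)
have kn : 0 + (n - 2 * k) + 2 * k = n by lia.
rewrite big_mkord; transitivity (binomial_sum (n - 2 * k) k); last first.
  by rewrite /binomial_sum; have -> : n - 2 * k + k = n - k by lia.
rewrite -(@card_tilings_suffix n 0) // suffix_region_full.
by apply: eq_card => P; rewrite !inE /tiling -andbA.
Qed.
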